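(* Let $\theta$ be a real number with $0<\theta\le 1$, and for $i=1,2,3,4$ put $\mu_i=1-10^{-10i}\theta$ and $\gamma_i=1+10^{100(i-5)}\theta$. Let $A$ be the $76\times 76$ diagonal matrix $$A=\mathrm{diag}(\mu_1,\mu_2,\mu_3,\mu_4,\gamma_1I_{18},\gamma_2I_{18},\gamma_3I_{18},\gamma_4I_{18}).$$ Then $A$ is not a real linear combination of three orthoprojections, i.e. there do not exist real numbers $\alpha_1,\alpha_2,\alpha_3$ and orthoprojections $P_1,P_2,P_3$ on $\mathbb{C}^{76}$ with $A=\alpha_1P_1+\alpha_2P_2+\alpha_3P_3$.
   Context: An orthoprojection on $\mathbb{C}^n$ is an $n\times n$ complex matrix $P$ with $P=P^*=P^2$. $I_k$ is the $k\times k$ identity matrix, and $\mathrm{diag}(\dots)$ denotes the (block) diagonal matrix with the listed diagonal entries or blocks. *)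

(* Defs.v *)
From mathcomp Require Import all_boot all_order all_algebra.
From mathcomp Require Import reals complex.

Set Implicit Arguments.
Unset Strict Implicit.
Unset Printing Implicit Defensive.

Import Order.TTheory GRing.Theory Num.Theory.
Local Open Scope ring_scope.
Local Open Scope complex_scope.

Definition orthoprojection (R : realType) (n : nat) (P : 'M[R[i]]_n) : Prop :=
  P = (P ^t*)%sesqui /\ P = P *m P.

(* The exponents are integers: [^] is the integer power of ssrint, taken in R. *)
Definition mu (R : realType) (theta : R) (i : nat) : R :=
  1 - 10 ^ (- (10 * i%:Z)) * theta.

Definition gamma (R : realType) (theta : R) (i : nat) : R :=
  1 + 10 ^ (100 * (i%:Z - 5)) * theta.

Definition diag_entries (R : realType) (theta : R) : seq R :=
  [:: mu theta 1; mu theta 2; mu theta 3; mu theta 4]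
  ++ nseq 18 (gamma theta 1) ++ nseq 18 (gamma theta 2)
  ++ nseq 18 (gamma theta 3) ++ nseq 18 (gamma theta 4).

(* So the default value of [nth] is never used in [A76]. *)
Lemma size_diag_entries (R : realType) (theta : R) :
  size (diag_entries theta) = 76.
Proof. by []. Qed.

Definition A76 (R : realType) (theta : R) : 'M[R[i]]_76 :=
  diag_mx (\row_(j < 76) ((diag_entries theta)`_j)%:C).

(* Main.v *)
Require Import Defs.
From mathcomp Require Import all_boot all_order all_algebra.
From mathcomp Require Import reals complex.
From mathcomp Require Import ring lra zify.

Set Implicit Arguments.
Unset Strict Implicit.
Unset Printing Implicit Defensive.

Import Order.TTheory GRing.Theory Num.Theory.
Local Open Scope ring_scope.
Local Open Scope complex_scope.

(** Replacing [P] by [1 - P] where a coefficient is negative turns a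
    decomposition of [A] into [A + t = a P + b Q + c S] with [a, b, c, t >= 0].
    Put [u = 1 + t]. The eigenvalues of [A + t] are [u - h1 < ... < u - h4],
    each simple, and [u + g1 < ... < u + g4], each of multiplicity 18, where
    [h1 >> h2 >> h3 >> h4 >> g4 >> g3 >> g2 >> g1 > 0]; the trace of [A - 1] is
    some [- T < 0] with [T] slightly larger than [h1].

    Since [A + t] is nearly the scalar [u], the three projections nearly split
    into the blocks that solve [a P + b Q + c S = u] exactly: one-dimensional
    blocks, on which some of the weights sum to [u], and two-dimensional ones,
    which need [a + b + c = 2 u]. The ranks of [P, Q, S] determine how many
    blocks there are of each type. The exact counterparts of this picture are
    dimension counts. By [weight_ge] and [weight_le], a one-dimensional type
    that occurs [m] times has its weight sum between the [m]-th lowest and the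
    [m]-th highest eigenvalue. By [pair_sum_ge] and its variants, which rest on
    the mirror symmetry of the spectrum of a combination of two projections
    ([pair_bound]), [a + b + c] is at least a sum of two eigenvalues.

    Weigh the excess of each type over [u] (over [2 u] for the two-dimensional
    one) by its number of occurrences: the total is the trace [- T]. A
    one-dimensional type with more than four occurrences has positive excess,
    since it avoids the four eigenvalues below [u], and two-dimensional blocks
    have nonnegative excess when there are many. A type with [m <= 4]
    occurrences has total excess at least [- m h_m >= - h1 > - T]. So two rare
    types would be needed, and these are excluded one by one: the multiplicities
    leave room for few combinations; a one-dimensional type with too many
    occurrences would be squeezed between two different [g_i], as each has
    multiplicity only 18; and three types at once give incompatible equations
    for [a, b, c]. [no_admissible_weights] carries out this case analysis over
    the sorted ranks. *)

(** * The real inner product of complex row vectors *)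

(** Only the real part of the Hermitian product is kept: every form in play is
    Hermitian with real weights, so the arguments become inequalities in [R]. *)
Definition ip (R : rcfType) (n : nat) (v w : 'rV[R[i]]_n) : R :=
  complex.Re ((v *m (w ^t*)%sesqui) 0 0).

Notation sqnorm v := (ip v v).

Section InnerProduct.
Variables (R : rcfType) (n : nat).
Implicit Types (v w : 'rV[R[i]]_n) (Q : 'M[R[i]]_n).

Lemma ReD (x y : R[i]) : complex.Re (x + y) = complex.Re x + complex.Re y.
Proof. by case: x y => ? ? []. Qed.

Lemma Re_sum (I : finType) (F : I -> R[i]) :
  complex.Re (\sum_j F j) = \sum_j complex.Re (F j).
Proof. by apply: (big_morph _ ReD). Qed.

Lemma ipE v w :
  ip v w = \sum_j (complex.Re (v 0 j) * complex.Re (w 0 j)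
                   + complex.Im (v 0 j) * complex.Im (w 0 j)).
Proof.
rewrite /ip mxE Re_sum; apply: eq_bigr => j _; rewrite !mxE.
case: (v 0 j) (w 0 j) => a b [c d] /=.
by rewrite mulrN opprK.
Qed.

Lemma ipC v w : ip v w = ip w v.
Proof.
rewrite !ipE; apply: eq_bigr => j _.
by rewrite ![complex.Re (v _ _) * _]mulrC ![complex.Im (v _ _) * _]mulrC.
Qed.

Lemma ipDl v1 v2 w : ip (v1 + v2) w = ip v1 w + ip v2 w.
Proof. by rewrite /ip mulmxDl mxE ReD. Qed.

Lemma ipDr v w1 w2 : ip v (w1 + w2) = ip v w1 + ip v w2.
Proof. by rewrite ipC ipDl !(ipC v). Qed.

Lemma ipZl (a : R) v w : ip (a%:C *: v) w = a * ip v w.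
Proof.
rewrite !ipE mulr_sumr; apply: eq_bigr => j _; rewrite mxE.
by case: (v 0 j) => x y /=; ring.
Qed.

Lemma ipZr (a : R) v w : ip v (a%:C *: w) = a * ip v w.
Proof. by rewrite ipC ipZl ipC. Qed.

Lemma ip0l w : ip 0 w = 0.
Proof. by rewrite ipE big1 // => j _; rewrite !mxE !mul0r addr0. Qed.

Lemma sqnorm_ge0 v : 0 <= sqnorm v.
Proof. by rewrite ipE sumr_ge0 // => j _; rewrite -!expr2 addr_ge0 ?sqr_ge0. Qed.

Lemma sqnorm_eq0 v : sqnorm v = 0 -> v = 0.
Proof.
rewrite ipE => /eqP; rewrite psumr_eq0 => [/allP v0 | j _]; last first.
  by rewrite -!expr2 addr_ge0 ?sqr_ge0.
apply/rowP => j; rewrite mxE; have := v0 j (mem_index_enum j); rewrite /= -!expr2.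
rewrite paddr_eq0 ?sqr_ge0 // !sqrf_eq0 => /andP[/eqP + /eqP].
by case: (v 0 j) => a b /= -> ->.
Qed.

Lemma sqnorm_gt0 v : v != 0 -> 0 < sqnorm v.
Proof.
by move=> vN0; rewrite lt0r sqnorm_ge0 andbT; apply: contraNneq vN0 => /sqnorm_eq0->.
Qed.

End InnerProduct.

(** * Ranks and kernels *)

Section Kernels.
Variables (F : fieldType).

Lemma rank_row_mx_le m n p (A : 'M[F]_(m, n)) (B : 'M[F]_(m, p)) :
  (\rank (row_mx A B) <= \rank A + \rank B)%N.
Proof.
rewrite -mxrank_tr tr_row_mx -addsmxE -(mxrank_tr A) -(mxrank_tr B).
by have [-> _] := mxrank_adds_leqif A^T B^T.
Qed.

Lemma rank_col_mx_le m n p (A : 'M[F]_(m, n)) (B : 'M[F]_(p, n)) :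
  (\rank (col_mx A B) <= \rank A + \rank B)%N.
Proof. by rewrite -addsmxE; have [-> _] := mxrank_adds_leqif A B. Qed.

Lemma exists_ker m n (A : 'M[F]_(m, n)) :
  (\rank A < m)%N -> exists2 v : 'rV_m, v != 0 & v *m A = 0.
Proof.
move=> rA; have /rowV0Pn[v /sub_kermxP vA v0] : kermx A != 0.
  by rewrite -mxrank_eq0 mxrank_ker subn_eq0 -ltnNge.
by exists v.
Qed.

Lemma mul_row_mx_eq0 m n p (A : 'M[F]_(m, n)) (B : 'M[F]_(m, p)) (v : 'rV_m) :
  v *m row_mx A B = 0 -> v *m A = 0 /\ v *m B = 0.
Proof. by rewrite mul_mx_row -row_mx0 => /eq_row_mx. Qed.

Lemma idem_rank_compl n (Q : 'M[F]_n) :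
  Q = Q *m Q -> (\rank (1%:M - Q)%R <= n - \rank Q)%N.
Proof.
move=> QQ; have := @mulmx0_rank_max _ _ _ _ Q (1%:M - Q).
by rewrite mulmxBr mulmx1 -QQ subrr => /(_ erefl); lia.
Qed.

(** A rank factorisation [Q = L U] of an idempotent has [U L = 1], and the trace
    does not see the order of the factors. *)
Lemma idem_trace n (Q : 'M[F]_n) : Q = Q *m Q -> \tr Q = (\rank Q)%:R.
Proof.
move=> QQ; have swap r (U C' : 'M_(r, n)) (L C : 'M_(n, r)) :
    L *m U = Q -> U *m C = 1%:M -> C' *m L = 1%:M -> U *m L = 1%:M.
  move=> QE UC CL; have := congr1 (fun M => C' *m M *m C) QQ.
  by rewrite /= -QE -!mulmxA UC !mulmx1 !mulmxA CL !mul1mx => ->.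
have [C UC] := row_freeP (row_base_free Q).
have [C' CL] := row_fullP (col_base_full Q).
have RC := swap _ _ _ _ _ (mulmx_base Q) UC CL.
by rewrite -{1}(mulmx_base Q) mxtrace_mulC RC mxtrace1.
Qed.

Lemma mul_pid_eq0 n j (v : 'rV[F]_n) (k : 'I_n) :
  v *m pid_mx j = 0 :> 'rV_n -> (k < j)%N -> v 0 k = 0.
Proof.
move=> /rowP/(_ k) + kj; rewrite !mxE (bigD1 k) //= big1 ?addr0 => [|i /negbTE ik].
  by rewrite mxE eqxx kj mulr1.
by rewrite mxE (inj_eq val_inj) ik mulr0.
Qed.

Lemma mul_copid_eq0 n j (v : 'rV[F]_n) (k : 'I_n) :
  v *m copid_mx j = 0 :> 'rV_n -> (j <= k)%N -> v 0 k = 0.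
Proof.
move=> /rowP/(_ k) + jk; rewrite mulmxBr mulmx1 !mxE (bigD1 k) //=.
rewrite big1 ?addr0 => [|i /negbTE ik].
  by rewrite mxE eqxx ltnNge jk mulr0 subr0.
by rewrite mxE (inj_eq val_inj) ik mulr0.
Qed.

End Kernels.

(** * Two orthoprojections *)

Section Projections.
Variables (R : realType) (n : nat).
Implicit Types (v w : 'rV[R[i]]_n) (P Q : 'M[R[i]]_n).

Lemma ip_adj Q v w : Q = (Q ^t*)%sesqui -> ip (v *m Q) w = ip v (w *m Q).
Proof.
by move=> QE; rewrite /ip trmx_mul map_mxM -[map_mx _ Q^T]QE mulmxA.
Qed.

Lemma orthoprojection_compl Q :
  orthoprojection Q -> orthoprojection (1%:M - Q).
Proof.
case=> Qh Qi; split; last first.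
  by rewrite mulmxBl mul1mx mulmxBr mulmx1 -Qi subrr subr0.
rewrite linearB /= trmx1 map_mxB map_mx1; congr (_ - _); exact: Qh.
Qed.

Lemma ip_proj Q v : orthoprojection Q -> ip (v *m Q) v = sqnorm (v *m Q).
Proof.
by case=> Qh Qi; rewrite {1}Qi mulmxA ip_adj.
Qed.

Lemma sqnorm_split Q v : orthoprojection Q ->
  sqnorm v = sqnorm (v *m Q) + sqnorm (v *m (1%:M - Q)).
Proof.
move=> oQ; rewrite -!ip_proj //; last exact: orthoprojection_compl.
by rewrite -ipDl -mulmxDr addrCA subrr addr0 mulmx1.
Qed.

Lemma sqnorm_proj_le Q v : orthoprojection Q -> sqnorm (v *m Q) <= sqnorm v.
Proof. by move=> oQ; rewrite (sqnorm_split v oQ) lerDl sqnorm_ge0. Qed.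

Lemma sqnorm_ker Q v : orthoprojection Q -> v *m (1%:M - Q) = 0 ->
  sqnorm (v *m Q) = sqnorm v.
Proof. by move=> oQ vQ; rewrite (sqnorm_split v oQ) vQ ip0l addr0. Qed.

(** With [C = b Q + c Q'], a Rayleigh quotient at least [x] forces
    [|C v|^2 >= x <C v, v>], as the expansion of [|C v - x v|^2 >= 0] shows.
    This moves information about [v] to the pair [(v Q, v Q')]. *)
Lemma form_sqr_ge Q Q' v (b c x : R) :
  orthoprojection Q -> orthoprojection Q' -> 0 <= x ->
  x * sqnorm v <= b * sqnorm (v *m Q) + c * sqnorm (v *m Q') ->
  x * (b * sqnorm (v *m Q) + c * sqnorm (v *m Q'))
    <= sqnorm (b%:C *: (v *m Q) + c%:C *: (v *m Q')).
Proof.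
move=> oQ oQ' x0 xF; set F := b * _ + c * _ in xF *; set u := _ + _.
have uv : ip u v = F by rewrite ipDl !ipZl !ip_proj.
clearbody u F.
have := sqnorm_ge0 (u + (- x)%:C *: v).
rewrite !(ipDl, ipDr, ipZl, ipZr) (ipC v u) uv.
have := mulr_ge0 x0 (_ : 0 <= F - x * sqnorm v); rewrite subr_ge0 => /(_ xF).
lra.
Qed.

(** The spectrum of [C = b Q + c Q'] is symmetric about [(b + c) / 2], up to
    multiplicities that the two ranks control. This is the form of that fact
    used below: if [C >= x] on [ker N] and [C >= y] on [ker N'], and these
    kernels are so large that an eigenvalue at least [x] must be the mirror
    image of one at least [y], then [x + y <= b + c].

    No eigenvector is computed. Otherwise pick [z] slightly below [y] with
    [x + z > b + c]; the dimensions give [v] in [ker N] and [w] in [ker N'] with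
    [v Q = (b - z) w Q] and [v Q' = - (c - z) w Q']. This substitution is the
    mirror: it exchanges the inequality saying [C >= z] at [w] with the one
    saying [C <= b + c - z] at [v], which contradicts [C >= x]. *)
Lemma pair_bound m m' Q Q' (N : 'M_(n, m)) (N' : 'M_(n, m')) (b c x y : R) :
  orthoprojection Q -> orthoprojection Q' -> 0 <= b -> 0 <= c ->
  (\rank N < n)%N -> (\rank N' + \rank Q < n)%N ->
  (\rank N' + \rank Q' < n)%N ->
  (\rank N + \rank N' + \rank Q + \rank Q' < n + n)%N ->
  (forall v, v *m N = 0 ->
     x * sqnorm v <= b * sqnorm (v *m Q) + c * sqnorm (v *m Q')) ->
  (forall v, v *m N' = 0 ->
     y * sqnorm v <= b * sqnorm (v *m Q) + c * sqnorm (v *m Q')) ->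
  x + y <= b + c.
Proof.
move=> oQ oQ' b0 c0 rN rN'Q rN'Q' rr Nx N'y; rewrite leNgt; apply/negP => xy.
have xbc : x <= b + c.
  have [v v0 vN] := exists_ker rN.
  have := Nx v vN; have := sqnorm_gt0 v0.
  have := sqnorm_proj_le v oQ; have := sqnorm_proj_le v oQ'.
  nra.
have yb : y <= b.
  have [|v v0 /mul_row_mx_eq0[vN' vQ]] := @exists_ker _ _ _ (row_mx N' Q').
    exact: leq_ltn_trans (rank_row_mx_le _ _) rN'Q'.
  have := N'y v vN'; rewrite vQ ip0l; have := sqnorm_gt0 v0.
  have := sqnorm_proj_le v oQ; nra.
have yc : y <= c.
  have [|v v0 /mul_row_mx_eq0[vN' vQ]] := @exists_ker _ _ _ (row_mx N' Q).
    exact: leq_ltn_trans (rank_row_mx_le _ _) rN'Q.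
  have := N'y v vN'; rewrite vQ ip0l; have := sqnorm_gt0 v0.
  have := sqnorm_proj_le v oQ'; nra.
(* Strictness of [z < y <= min b c] keeps both scaling factors positive. *)
pose z := (y + (b + c - x)) / 2.
have z2 : z * 2 = y + (b + c - x) by rewrite /z; field.
have [b_gt0 c_gt0] : 0 < b /\ 0 < c by split; lra.
have [z0 zy xz] : [/\ 0 < z, z < y & b + c < x + z] by split; lra.
have x0 : 0 < x by lra.
pose s := b - z; pose t := c - z.
have [s0 t0] : 0 < s /\ 0 < t by rewrite /s /t; split; lra.
(* A linear system for the concatenated unknown [(v, w)], of rank too small to
   be injective. *)
have : (\rank (row_mx (row_mx (col_mx N 0) (col_mx (0 : 'M_(n, m')) N'))
  (row_mx (col_mx 1%:M (- (s%:C)%:M) *m Q)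
          (col_mx 1%:M (t%:C)%:M *m Q'))) < n + n)%N.
  apply: leq_ltn_trans rr.
  apply: leq_trans (rank_row_mx_le _ _) _; rewrite -addnA.
  apply: leq_add; apply: leq_trans (rank_row_mx_le _ _) _; apply: leq_add.
  - by apply: leq_trans (rank_col_mx_le _ _) _; rewrite mxrank0 addn0.
  - by apply: leq_trans (rank_col_mx_le _ _) _; rewrite mxrank0.
  - exact: mxrankM_maxr.
  - exact: mxrankM_maxr.
move=> /exists_ker[vw vw0].
move=> /mul_row_mx_eq0[/mul_row_mx_eq0[vN vN'] /mul_row_mx_eq0[vQ vQ']].
move: vN vN' vQ vQ' vw0.
rewrite -[vw]hsubmxK !mulmxA; move: (lsubmx vw) (rsubmx vw) => v w.
rewrite !mul_row_col !mulmx0 addr0 add0r !mulmx1 mulmxN !mul_mx_scalar.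
rewrite mulmxDl mulNmx -scalemxAl mulmxDl -scalemxAl => vN wN' /eqP.
rewrite subr_eq0 => /eqP vQ /eqP; rewrite addr_eq0 => /eqP vQ' vw0.
have {N'y} wy : z * sqnorm w <= b * sqnorm (w *m Q) + c * sqnorm (w *m Q').
  by apply: le_trans (N'y w wN'); rewrite ler_wpM2r ?sqnorm_ge0 ?ltW.
have {Nx} vx := Nx v vN.
have := form_sqr_ge oQ oQ' (ltW z0) wy; have := form_sqr_ge oQ oQ' (ltW x0) vx.
have sE : s = b - z by []. have tE : t = c - z by []. clearbody s t z.
move: vx wy; rewrite vQ vQ' -scaleNr -(rmorphN (real_complex R)).
move: (w *m Q) (w *m Q') {vQ vQ'} => p q.
have -> : sqnorm (s%:C *: p) = s * (s * sqnorm p) by rewrite ipZl ipZr.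
have -> : sqnorm ((- t)%:C *: q) = t * (t * sqnorm q).
  by rewrite ipZl ipZr; ring.
have -> : sqnorm (b%:C *: p + c%:C *: q)
    = b * (b * sqnorm p) + c * (c * sqnorm q) + 2 * b * c * ip p q.
  by rewrite ipDl !ipDr !ipZl !ipZr (ipC q p); ring.
have -> : sqnorm (b%:C *: (s%:C *: p) + c%:C *: ((- t)%:C *: q))
    = b * b * s * s * sqnorm p + c * c * t * t * sqnorm q
      - 2 * b * c * s * t * ip p q.
  by rewrite ipDl !ipDr !ipZl !ipZr (ipC q p); ring.
have := sqnorm_ge0 p; have := sqnorm_ge0 q; have := sqnorm_ge0 v.
have := sqnorm_ge0 w; have := @sqnorm_eq0 _ _ v; have := @sqnorm_eq0 _ _ w.
move: vw0; rewrite row_mx_eq0.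
move: (sqnorm v) (sqnorm w) (sqnorm p) (sqnorm q) (ip p q) => V W A B I.
move=> vw0 W0 V0 W_ge0 V_ge0 B_ge0 A_ge0 Vx Wz xG zw.
have bzA : b = s + z by lra.
have czB : c = t + z by lra.
pose G := b * (s * (s * A)) + c * (t * (t * B)).
have pA : 0 <= b * (s * (s * A)) by rewrite !mulr_ge0 // ltW.
have pB : 0 <= c * (t * (t * B)) by rewrite !mulr_ge0 // ltW.
have G_ge0 : 0 <= G by apply: addr_ge0.
(* [C >= z] at [w], with [b - z = s] and [c - z = t]. *)
have I_ge : 0 <= b * s * A + c * t * B + 2 * b * c * I.
  have -> : b * s * A + c * t * B + 2 * b * c * I = b * (b * A) + c * (c * B)
    + 2 * b * c * I - z * (b * A + c * B) by rewrite bzA czB; ring.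
  by rewrite subr_ge0.
(* Adding [s * t] times the previous line cancels the mixed term [I]. *)
have G_le : (x + z - (b + c)) * G <= 0.
  have := mulr_ge0 (mulr_ge0 (ltW s0) (ltW t0)) I_ge.
  move: xG; rewrite -subr_ge0 => h1 h2; have := addr_ge0 h1 h2.
  by rewrite -oppr_ge0; congr (0 <= _); rewrite /G bzA czB; ring.
have G0 : G = 0.
  apply/eqP; rewrite eq_le G_ge0 andbT leNgt; apply/negP => G_gt0.
  by move: G_le; rewrite leNgt mulr_gt0 // subr_gt0.
move/eqP: (G0); rewrite /G paddr_eq0 // !mulf_eq0.
rewrite !(gt_eqF b_gt0, gt_eqF c_gt0, gt_eqF s0, gt_eqF t0) /=.
move=> /andP[/eqP A0 /eqP B0].
have VW (k U : R) : 0 < k -> 0 <= U -> k * U <= 0 -> U = 0.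
  by move=> k0 U0 kU; apply/eqP; rewrite eq_le U0 andbT -(pmulr_rle0 _ k0).
move: Vx Wz; rewrite A0 B0 !mulr0 addr0 => Vx Wz.
case/negP: vw0.
by rewrite (V0 (VW _ _ x0 V_ge0 Vx)) (W0 (VW _ _ z0 W_ge0 Wz)) !eqxx.
Qed.

End Projections.

(** * Diagonal matrices that combine three orthoprojections *)

Section DiagonalForm.
Variables (R : realType) (n : nat) (e : nat -> R).
Hypothesis e_mono : forall j k, (j <= k < n)%N -> e j <= e k.
Let A : 'M[R[i]]_n := diag_mx (\row_(j < n) (e j)%:C).

Lemma ip_diag (v : 'rV[R[i]]_n) :
  ip (v *m A) v
  = \sum_(j < n) e j * (complex.Re (v 0 j) ^+ 2 + complex.Im (v 0 j) ^+ 2).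
Proof.
rewrite ipE; apply: eq_bigr => j _; rewrite mul_mx_diag !mxE.
by case: (v 0 j) => x y /=; ring.
Qed.

Lemma sqnormE (v : 'rV[R[i]]_n) :
  sqnorm v = \sum_j (complex.Re (v 0 j) ^+ 2 + complex.Im (v 0 j) ^+ 2).
Proof. by rewrite ipE; apply: eq_bigr => j _; rewrite !expr2. Qed.

Lemma ip_diag_ge j (v : 'rV[R[i]]_n) : v *m (pid_mx j : 'M_n) = 0 ->
  e j * sqnorm v <= ip (v *m A) v.
Proof.
move=> vj; rewrite ip_diag sqnormE mulr_sumr; apply: ler_sum => k _.
have [kj|jk] := ltnP k j; last first.
  by rewrite ler_wpM2r ?addr_ge0 ?sqr_ge0 // e_mono // jk /=.
by rewrite (mul_pid_eq0 vj kj) /= expr0n addr0 !mulr0.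
Qed.

Lemma ip_diag_le j (v : 'rV[R[i]]_n) : (j < n)%N ->
  v *m (copid_mx j.+1 : 'M_n) = 0 -> ip (v *m A) v <= e j * sqnorm v.
Proof.
move=> jn vj; rewrite ip_diag sqnormE mulr_sumr; apply: ler_sum => k _.
have [jk|kj] := ltnP j k; last first.
  by rewrite ler_wpM2r ?addr_ge0 ?sqr_ge0 // e_mono // kj.
by rewrite (mul_copid_eq0 vj jk) /= expr0n addr0 !mulr0.
Qed.

(** The next two lemmas are the Courant-Fischer bounds for the nondecreasing
    diagonal [e]: a kernel of dimension more than [j] meets the span of the
    coordinates from [j] on, and one of dimension at least [n - j] the span of
    those up to [j]. *)
Lemma entry_le m (N : 'M[R[i]]_(n, m)) (c : R) j : (\rank N + j < n)%N ->
  (forall v, v *m N = 0 -> ip (v *m A) v <= c * sqnorm v) -> e j <= c.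
Proof.
move=> rN Nc; have [|v v0 /mul_row_mx_eq0[vN vj]] :=
    @exists_ker _ _ _ (row_mx N (pid_mx j : 'M_n)).
  apply: leq_ltn_trans (rank_row_mx_le _ _) (leq_ltn_trans _ rN).
  by rewrite leq_add2l rank_pid_mx //; lia.
have := le_trans (ip_diag_ge vj) (Nc v vN).
by rewrite ler_pM2r // sqnorm_gt0.
Qed.

Lemma entry_ge m (N : 'M[R[i]]_(n, m)) (c : R) j : (\rank N <= j < n)%N ->
  (forall v, v *m N = 0 -> c * sqnorm v <= ip (v *m A) v) -> c <= e j.
Proof.
move=> /andP[rN jn] Nc; have [|v v0 /mul_row_mx_eq0[vN vj]] :=
    @exists_ker _ _ _ (row_mx N (copid_mx j.+1 : 'M_n)).
  apply: leq_ltn_trans (rank_row_mx_le _ _) _.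
  by rewrite rank_copid_mx //; lia.
have := le_trans (Nc v vN) (ip_diag_le jn vj).
by rewrite ler_pM2r // sqnorm_gt0.
Qed.

Section ThreeProjections.
Variables (a b c : R) (P Q S : 'M[R[i]]_n).
Hypotheses (a_ge0 : 0 <= a) (b_ge0 : 0 <= b) (c_ge0 : 0 <= c).
Hypotheses (oP : orthoprojection P) (oQ : orthoprojection Q).
Hypothesis (oS : orthoprojection S).
Hypothesis AE : A = a%:C *: P + b%:C *: Q + c%:C *: S.

Lemma ip_comb (v : 'rV[R[i]]_n) : ip (v *m A) v =
  a * sqnorm (v *m P) + b * sqnorm (v *m Q) + c * sqnorm (v *m S).
Proof.
by rewrite AE !mulmxDr -!scalemxAr !ipDl !ipZl !ip_proj.
Qed.

Lemma trace_comb : \sum_(j < n) e j =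
  a * (\rank P)%:R + b * (\rank Q)%:R + c * (\rank S)%:R.
Proof.
have trP (T : 'M[R[i]]_n) (x : R) : orthoprojection T ->
    complex.Re (\tr (x%:C *: T)) = x * (\rank T)%:R.
  case=> _ TT; rewrite mxtraceZ idem_trace // -(rmorph_nat (real_complex R)) /=.
  by rewrite mul0r subr0.
rewrite -!trP // -!ReD -!mxtraceD -AE /mxtrace Re_sum.
by apply: eq_bigr => j _; rewrite !mxE eqxx.
Qed.

(** Orthoprojections are positive, so a sum of them kills only common kernel
    vectors; hence a sum serves as one matrix encoding several conditions. *)
Lemma sum_ker (T1 T2 T3 : 'M[R[i]]_n) (v : 'rV[R[i]]_n) :
  orthoprojection T1 -> orthoprojection T2 -> orthoprojection T3 ->
  v *m (T1 + T2 + T3) = 0 -> [/\ v *m T1 = 0, v *m T2 = 0 & v *m T3 = 0].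
Proof.
move=> o1 o2 o3 vT; have : ip (v *m (T1 + T2 + T3)) v = 0 by rewrite vT ip0l.
rewrite !mulmxDr !ipDl !ip_proj // => /eqP.
rewrite !paddr_eq0 ?addr_ge0 ?sqnorm_ge0 //.
by case/andP=> /andP[/eqP/sqnorm_eq0-> /eqP/sqnorm_eq0->] /eqP/sqnorm_eq0->.
Qed.

Lemma orthoprojection0 : orthoprojection (0 : 'M[R[i]]_n).
Proof. by split; rewrite ?mulmx0 // trmx0 map_mx0. Qed.

Lemma rank_add3_le (T1 T2 T3 : 'M[R[i]]_n) :
  (\rank (T1 + T2 + T3)%R <= \rank T1 + \rank T2 + \rank T3)%N.
Proof.
apply: leq_trans (mxrank_add _ _) _.
by rewrite leq_add2r mxrank_add.
Qed.

(** On the common kernel of the projections outside a subset, the form is at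
    most the total weight of that subset. The Booleans tell which of the three
    projections belong to the subset. *)
Lemma weight_ge (s t r : bool) j :
  ((if s then 0 else \rank P) + (if t then 0 else \rank Q)
    + (if r then 0 else \rank S) + j < n)%N ->
  e j <= (if s then a else 0) + (if t then b else 0) + (if r then c else 0).
Proof.
move=> rk; have o0 := orthoprojection0.
pose N := (if s then 0 else P) + (if t then 0 else Q) + (if r then 0 else S).
apply: (@entry_le _ N) => [|v /sum_ker[]].
- apply: leq_ltn_trans rk; rewrite leq_add2r.
  apply: leq_trans (rank_add3_le _ _ _) _.
  by rewrite !leq_add //; case: ifP => // _; rewrite ?mxrank0.
- by case: ifP.
- by case: ifP.
- by case: ifP.
move=> vP vQ vS; rewrite ip_comb !mulrDl.
have term (u : bool) (x : R) (T : 'M[R[i]]_n) : 0 <= x -> orthoprojection T ->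
    v *m (if u then 0 else T) = 0 ->
    x * sqnorm (v *m T) <= (if u then x else 0) * sqnorm v.
  move=> x0 oT; case: u => [_|->]; last by rewrite ip0l mulr0 mul0r.
  by rewrite ler_wpM2l // sqnorm_proj_le.
by rewrite !lerD // term.
Qed.

(** On the common range of the projections in a subset, the form is at least
    the total weight of that subset. *)
Lemma weight_le (s t r : bool) j : (j < n)%N ->
  ((if s then n - \rank P else 0) + (if t then n - \rank Q else 0)
    + (if r then n - \rank S else 0) <= j)%N ->
  (if s then a else 0) + (if t then b else 0) + (if r then c else 0) <= e j.
Proof.
move=> jn rk; have o0 := orthoprojection0.
pose N := (if s then 1%:M - P else 0) + (if t then 1%:M - Q else 0)
  + (if r then 1%:M - S else 0).
have oC := orthoprojection_compl.
have rC (T : 'M[R[i]]_n) : orthoprojection T ->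
  (\rank (1%:M - T)%R <= n - \rank T)%N by case=> _ /idem_rank_compl.
apply: (@entry_ge _ N) => [|v /sum_ker[]].
- rewrite jn andbT; apply: leq_trans rk.
  apply: leq_trans (rank_add3_le _ _ _) _.
  by rewrite !leq_add //; case: ifP => // _; rewrite ?mxrank0 ?rC.
- by case: ifP => // _; apply: oC.
- by case: ifP => // _; apply: oC.
- by case: ifP => // _; apply: oC.
move=> vP vQ vS; rewrite ip_comb !mulrDl.
have term (u : bool) (x : R) (T : 'M[R[i]]_n) : 0 <= x -> orthoprojection T ->
    v *m (if u then 1%:M - T else 0) = 0 ->
    (if u then x else 0) * sqnorm v <= x * sqnorm (v *m T).
  move=> x0 oT; case: u => [vT|_]; first by rewrite sqnorm_ker.
  by rewrite mul0r mulr_ge0 ?sqnorm_ge0.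
by rewrite !lerD // term.
Qed.

(** There are two ways to bound [b Q + c S] below by the diagonal: restrict to
    the kernel of [P], which costs the rank of [P] in dimension, or lose [a] in
    value everywhere. The three pair inequalities combine them. *)
Let kerX j := row_mx P (pid_mx j : 'M_n).

Lemma kerX_form j v : v *m kerX j = 0 ->
  e j * sqnorm v <= b * sqnorm (v *m Q) + c * sqnorm (v *m S).
Proof.
move=> /mul_row_mx_eq0[vP /ip_diag_ge]; rewrite ip_comb vP ip0l mulr0 add0r.
exact.
Qed.

Lemma shift_form j v : v *m (pid_mx j : 'M_n) = 0 ->
  (e j - a) * sqnorm v <= b * sqnorm (v *m Q) + c * sqnorm (v *m S).
Proof.
move=> /ip_diag_ge; rewrite ip_comb mulrBl lerBlDr => h; apply: le_trans h _.
by rewrite -addrA addrC lerD2l ler_wpM2l // sqnorm_proj_le.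
Qed.

Let rank_kerX j : (j <= n)%N -> (\rank (kerX j) <= \rank P + j)%N.
Proof.
by move=> jn; rewrite (leq_trans (rank_row_mx_le _ _)) // rank_pid_mx.
Qed.

Let rank_pid j : (j <= n)%N -> \rank (pid_mx j : 'M[R[i]]_n) = j.
Proof. by move=> jn; rewrite rank_pid_mx. Qed.

Lemma pair_sum_ge j l : (\rank P + j < n)%N -> (l + \rank Q < n)%N ->
  (l + \rank S < n)%N -> (\rank P + \rank Q + \rank S + j + l < n + n)%N ->
  e j + e l <= a + b + c.
Proof.
move=> Pj lQ lS PQS.
have rX := @rank_kerX j ltac:(lia); have rY := @rank_pid l ltac:(lia).
have := pair_bound oQ oS b_ge0 c_ge0 _ _ _ _ (@kerX_form j) (@shift_form l).
rewrite rY => /(_ ltac:(lia) ltac:(lia) ltac:(lia) ltac:(lia)); lra.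
Qed.

Lemma pair_sum_ge_shift j l : (j < n)%N -> (l + \rank Q < n)%N ->
  (l + \rank S < n)%N -> (\rank Q + \rank S + j + l < n + n)%N ->
  e j + e l <= a + a + b + c.
Proof.
move=> jn lQ lS QS.
have rX := @rank_pid j ltac:(lia); have rY := @rank_pid l ltac:(lia).
have := pair_bound oQ oS b_ge0 c_ge0 _ _ _ _ (@shift_form j) (@shift_form l).
rewrite rX rY => /(_ ltac:(lia) ltac:(lia) ltac:(lia) ltac:(lia)); lra.
Qed.

Lemma pair_sum_ge_ker j l :
  (\rank P + j < n)%N -> (\rank P + l + \rank Q < n)%N ->
  (\rank P + l + \rank S < n)%N ->
  (\rank P + \rank P + \rank Q + \rank S + j + l < n + n)%N ->
  e j + e l <= b + c.
Proof.
move=> Pj lQ lS PQS.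
have rX := @rank_kerX j ltac:(lia); have rY := @rank_kerX l ltac:(lia).
by apply: (pair_bound oQ oS b_ge0 c_ge0 _ _ _ _ (@kerX_form j) (@kerX_form l)); lia.
Qed.

End ThreeProjections.
End DiagonalForm.

(** * The arithmetic of weights and ranks *)

(** Integer arithmetic that first clears the (in)equalities between field
    elements, whose analysis by [lia] is prohibitively slow. *)
Ltac natlia :=
  repeat match goal with
  | H : is_true (Order.le _ _) |- _ => clear H
  | H : is_true (Order.lt _ _) |- _ => clear H
  | H : @eq (_ _) _ _ |- _ => clear H
  end; lia.

Section Arithmetic.
Variables (R : realFieldType) (h1 h2 h3 h4 g1 g2 g3 g4 : R).

(** The spectrum of [A] minus 1: positions 0 to 3 hold the four negative
    values, 4 to 21, 22 to 39, 40 to 57 and 58 to 75 the four positive ones. *)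
Definition ladder (j : nat) : R :=
  ([:: - h1; - h2; - h3; - h4]
   ++ nseq 18 g1 ++ nseq 18 g2 ++ nseq 18 g3 ++ nseq 18 g4)`_j.

(** All that is used of the actual sizes, with much room to spare. *)
Definition scales_separated : Prop :=
  [/\ [/\ 0 < g1, g1 < g2, g2 < g3 & 2 * g3 < g4], 10 * g4 <= h4,
      [/\ 10 * h4 <= h3, 10 * h3 <= h2 & 10 * h2 <= h1] & 20 * (20 * h1) <= 1].

Hypothesis sep : scales_separated.

(* Minus the sum of [ladder], positive because [h1] dominates. *)
Let T := h1 + h2 + h3 + h4 - 18 * (g1 + g2 + g3 + g4).

Lemma T_bounds : [/\ 0 < h1, 0 < h2, h1 < T, h1 + h2 < T & h1 + 3 * h3 < T].
Proof. by case: sep => -[? ? ? ?] ? [? ? ?] ?; split; rewrite /T; lra. Qed.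

Lemma ladder_pos j : (4 <= j < 76)%N -> 0 < ladder j.
Proof.
case: sep => -[? ? ? ?] _ _ _ /andP[j4 j76].
have [? ? ? ?] : [/\ 0 < g1, 0 < g2, 0 < g3 & 0 < g4] by split; lra.
rewrite /ladder nth_cat; case: ltnP => [|_]; first by rewrite /=; lia.
do 3 (rewrite nth_cat size_nseq; case: ifP => [lt|_]; first by rewrite nth_nseq lt).
rewrite nth_nseq ifT //; move: j76; rewrite /=; lia.
Qed.

(** Weights [a], [b], [c] of projections of ranks [d1 >= d2 >= d3], whose
    weighted sum has the eigenvalues [u + ladder j]. *)
Variables (u a b c : R) (d1 d2 d3 : nat).
Hypotheses (d1_le : (d1 <= 76)%N) (d21 : (d2 <= d1)%N) (d32 : (d3 <= d2)%N).
Hypotheses (u_ge1 : 1 <= u) (a_ge0 : 0 <= a) (b_ge0 : 0 <= b) (c_ge0 : 0 <= c).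
Hypothesis trace : a * d1%:R + b * d2%:R + c * d3%:R = 76 * u - T.
Hypothesis wge : forall (s t r : bool) j,
  ((if s then 0 else d1) + (if t then 0 else d2) + (if r then 0 else d3)
    + j < 76)%N ->
  u + ladder j <= (if s then a else 0) + (if t then b else 0)
                  + (if r then c else 0).
Hypothesis wle : forall (s t r : bool) j, (j < 76)%N ->
  ((if s then 76 - d1 else 0) + (if t then 76 - d2 else 0)
    + (if r then 76 - d3 else 0) <= j)%N ->
  (if s then a else 0) + (if t then b else 0) + (if r then c else 0)
  <= u + ladder j.
Hypothesis pair : forall j l, (d1 + j < 76)%N -> (l + d2 < 76)%N ->
  (l + d3 < 76)%N -> (d1 + d2 + d3 + j + l < 152)%N ->
  2 * u + ladder j + ladder l <= a + b + c.
Hypothesis pair_shift : forall j l, (j < 76)%N -> (l + d2 < 76)%N ->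
  (l + d3 < 76)%N -> (d2 + d3 + j + l < 152)%N ->
  2 * u + ladder j + ladder l <= a + a + b + c.
Hypothesis pair_ker : forall j l, (d3 + j < 76)%N -> (d3 + l + d1 < 76)%N ->
  (d3 + l + d2 < 76)%N -> (d3 + d3 + d1 + d2 + j + l < 152)%N ->
  2 * u + ladder j + ladder l <= a + b.

(* Bounds for the sums over each subset: below, then above. *)
Let La j : (d2 + d3 + j < 76)%N -> u + ladder j <= a.
Proof. by move=> h; have := @wge true false false j; rewrite /= !addr0; apply; lia. Qed.
Let Lb j : (d1 + d3 + j < 76)%N -> u + ladder j <= b.
Proof. by move=> h; have := @wge false true false j; rewrite /= add0r addr0; apply; lia. Qed.
Let Lc j : (d1 + d2 + j < 76)%N -> u + ladder j <= c.
Proof. by move=> h; have := @wge false false true j; rewrite /= !add0r; apply; lia. Qed.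
Let Lab j : (d3 + j < 76)%N -> u + ladder j <= a + b.
Proof. by move=> h; have := @wge true true false j; rewrite /= addr0; apply; lia. Qed.
Let Lac j : (d2 + j < 76)%N -> u + ladder j <= a + c.
Proof. by move=> h; have := @wge true false true j; rewrite /= addr0; apply; lia. Qed.
Let Lbc j : (d1 + j < 76)%N -> u + ladder j <= b + c.
Proof. by move=> h; have := @wge false true true j; rewrite /= add0r; apply; lia. Qed.
Let Labc j : (j < 76)%N -> u + ladder j <= a + b + c.
Proof. by move=> h; have := @wge true true true j; apply. Qed.
Let Ua j : (j < 76)%N -> (76 - d1 <= j)%N -> a <= u + ladder j.
Proof.
by move=> h h'; have := @wle true false false j h; rewrite /= !addr0; apply; lia.
Qed.
Let Uab j : (j < 76)%N -> (152 <= d1 + d2 + j)%N -> a + b <= u + ladder j.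
Proof.
by move=> h h'; have := @wle true true false j h; rewrite /= !addr0; apply; lia.
Qed.
Let Uac j : (j < 76)%N -> (152 <= d1 + d3 + j)%N -> a + c <= u + ladder j.
Proof.
by move=> h h'; have := @wle true false true j h; rewrite /= !addr0; apply; lia.
Qed.
Let Ubc j : (j < 76)%N -> (152 <= d2 + d3 + j)%N -> b + c <= u + ladder j.
Proof.
by move=> h h'; have := @wle false true true j h; rewrite /= !add0r; apply; lia.
Qed.
Let Uabc j : (j < 76)%N -> (228 <= d1 + d2 + d3 + j)%N -> a + b + c <= u + ladder j.
Proof. by move=> h h'; have := @wle true true true j h; apply; lia. Qed.

(** [x] is the weight sum of a one-dimensional type occurring [m] times, and
    [m * (x - u)] is the share of this type in the trace. *)
Let mult (m : nat) (x : R) := forall j, (j < m)%N -> u + ladder j <= x.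

(** A type that occurs more than four times avoids the four negative
    eigenvalues. *)
Lemma mult_gt m x : (4 < m <= 76)%N -> mult m x -> u < x.
Proof.
move=> m5 /(_ 4); rewrite (_ : (4 < m)%N) ?(andP m5).1 // => /(_ isT).
by have := @ladder_pos 4 isT; move: (ladder 4) => l; lra.
Qed.

(** If [m <= 4], the value is at least the [m]-th lowest eigenvalue, so the
    share is at least [- m * h_m], and the [h_i] decrease faster than
    [m] grows. The finer bounds serve when two rare types compete. *)
Lemma defect_ge m x : (m <= 76)%N -> mult m x ->
  [/\ - h1 <= m%:R * (x - u), m != 1%N -> - (2 * h2) <= m%:R * (x - u)
    & odd m -> m != 1%N -> - (3 * h3) <= m%:R * (x - u)].
Proof.
move=> m76 mx; case: sep => -[? ? ? ?] ? [? ? ?] ?.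
have [hp1 hp2 hp3 hp4] : [/\ 0 < h1, 0 < h2, 0 < h3 & 0 < h4] by split; lra.
case: m m76 mx => [|[|[|[|[|m]]]]] m76 mx.
- by rewrite mul0r; split=> //; lra.
- by have := mx 0 isT; rewrite /ladder /= mul1r => ?; split=> //; lra.
- by have := mx 1 isT; rewrite /ladder /= => ?; split=> [|_|_ _] //; lra.
- by have := mx 2 isT; rewrite /ladder /= => ?; split=> [|_|_ _] //; lra.
- by have := mx 3 isT; rewrite /ladder /= => ?; split=> [|_|_ _] //; lra.
have : 0 <= m.+1.+4%:R * (x - u).
  by rewrite mulr_ge0 // subr_ge0 ltW // (@mult_gt m.+1.+4).
by move=> ?; split=> [|_|_ _]; lra.
Qed.

(** Two types together could only reach [- T] with multiplicities (1, 1) or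
    (1, 2); parity excludes the latter. *)
Lemma defect_pair_ge m x m' y : (m <= 76)%N -> (m' <= 76)%N ->
  mult m x -> mult m' y -> ~~ odd (m + m') -> ~~ ((m == 1) && (m' == 1))%N ->
  - T < m%:R * (x - u) + m'%:R * (y - u).
Proof.
move=> m76 m'76 mx my; rewrite oddD.
have [x1 x2 x3] := defect_ge m76 mx; have [y1 y2 y3] := defect_ge m'76 my.
move: (m%:R * _) (m'%:R * _) x1 x2 x3 y1 y2 y3 => X Y x1 x2 x3 y1 y2 y3.
have [_ _ _ ? ?] := T_bounds; case: sep => -[? ? ? ?] ? [? ? ?] ? par not11.
have [m1|mN1] := eqVneq m 1%N.
  move: not11 par; rewrite m1 /= => m'N1; case: (odd m') y3 => // /(_ isT m'N1).
  by lra.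
have [m'1|m'N1] := eqVneq m' 1%N.
  by move: par; rewrite m'1 /=; case: (odd m) x3 => // /(_ isT mN1); lra.
by have := x2 mN1; have := y2 m'N1; lra.
Qed.

Let natr_sum x y z : (x + y = z)%N -> x%:R + y%:R = z%:R :> R.
Proof. by move=> <-; rewrite natrD. Qed.

Let term_ge0 (m : nat) (x : R) : 0 <= x -> 0 <= m%:R * x.
Proof. by move=> x0; rewrite mulr_ge0. Qed.

Let u_le j x : (4 <= j < 76)%N -> u + ladder j <= x -> 0 <= x - u.
Proof. by move=> /ladder_pos jp h; rewrite subr_ge0 (le_trans _ h) // lerDl ltW. Qed.

(** The types are [a], [b] and [d3] two-dimensional blocks. If [b], the rarer of
    the first two, occurs five times, both values are above [u]. Otherwise
    either there are at most four blocks, and [a] occurs so often that it would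
    have to be both above [u + g4] and below [u + g1], or [pair] shows that the
    blocks have nonnegative excess, and what remains is too rare to carry the
    negative trace. *)
Lemma tight_pair_false : (d1 + d2 = 76)%N -> False.
Proof.
move=> D12; have [m1 d1E] : {m1 | d1 = d3 + m1}%N by exists (d1 - d3)%N; lia.
have [m2 d2E] : {m2 | d2 = d3 + m2}%N by exists (d2 - d3)%N; lia.
have ma : mult m1 a by move=> j jm; apply: La; lia.
have mb : mult m2 b by move=> j jm; apply: Lb; lia.
have tr : m1%:R * (a - u) + m2%:R * (b - u) + d3%:R * (a + b + c - 2 * u) = - T.
  have := natr_sum D12; have := trace; rewrite d1E d2E !natrD => t1 t2.
  by have := congr1 (fun z => u * z) t2; lra.
have [h1p h2p T1 T2 T3] := T_bounds.
have [m2_gt4|m2_le4] := ltnP 4 m2.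
  have ua := @mult_gt m1 a ltac:(natlia) ma; have ub := @mult_gt m2 b ltac:(natlia) mb.
  have := @term_ge0 m1 (a - u) ltac:(lra); have := @term_ge0 m2 (b - u) ltac:(lra).
  have := @term_ge0 d3 (a + b + c - 2 * u) ltac:(have := c_ge0; lra).
  lra.
have [d1_ge72|d1_lt72] := leqP 72 d1.
  have := @La 58 ltac:(natlia); have := @Ua 4 isT ltac:(natlia); rewrite /ladder /=.
  case: sep => -[? ? ? ?] _ _ _; lra.
have := @pair 4 4 ltac:(natlia) ltac:(natlia) ltac:(natlia) ltac:(natlia).
have g4p := @ladder_pos 4 isT => p44.
have := @term_ge0 d3 (a + b + c - 2 * u) ltac:(lra) => ptr.
have [m1_gt4|m1_le4] := ltnP 4 m1.
  have ua := @mult_gt m1 a ltac:(natlia) ma.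
  have := @term_ge0 m1 (a - u) ltac:(lra).
  by have [db _ _] := @defect_ge m2 b ltac:(natlia) mb; lra.
have [/andP[/eqP m11 /eqP m21]|not11] := boolP ((m1 == 1) && (m2 == 1))%N.
  (* Here [d1 = d2 = 38] and [d3 = 37]: separate bounds for [a] and [b] give
     only [- 2 * h1], so their sum is bounded directly. *)
  have {}m11 : m1 = 1%N := m11; have {}m21 : m2 = 1%N := m21.
  have := @pair_ker 1 0 ltac:(natlia) ltac:(natlia) ltac:(natlia) ltac:(natlia).
  by move: tr; rewrite m11 m21 /ladder /=; lra.
have := @defect_pair_ge m1 a m2 b ltac:(natlia) ltac:(natlia) ma mb ltac:(natlia) not11.
lra.
Qed.

(** All weights are at least about [u]. So the trace excludes a rank sum above
    76 and positivity one below 76; for equality the projections nearly split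
    the space, and only the types [a], [b], [c] share the trace. *)
Lemma slack_pairs_false : (d1 + d2 < 76)%N -> False.
Proof.
move=> D12; have [h1p h2p T1 T2 T3] := T_bounds; case: sep => -[? ? ? ?] _ _ h1s.
have := @La 0 ltac:(natlia); have := @Lb 0 ltac:(natlia); have := @Lc 0 ltac:(natlia).
rewrite /ladder /= => c0 b0 a0.
case: (ltngtP (d1 + d2 + d3)%N 76) => D.
- have := @wge false false false 0 ltac:(rewrite addn0; exact: D).
  rewrite /ladder /=; have := u_ge1; lra.
- have := trace; have := u_ge1.
  have := ler_wpM2r (ler0n R d1) a0; have := ler_wpM2r (ler0n R d2) b0.
  have := ler_wpM2r (ler0n R d3) c0.
  have DR : 77 <= d1%:R + d2%:R + d3%:R :> R by rewrite -!natrD ler_nat.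
  move=> x1 x2 x3 u1 t.
  have : 0 <= (u - h1) * (d1%:R + d2%:R + d3%:R - 77).
    by apply: mulr_ge0; rewrite ?subr_ge0 //; lra.
  lra.
have tr : d1%:R * (a - u) + d2%:R * (b - u) + d3%:R * (c - u) = - T.
  have t2 := natr_sum D; have := trace; rewrite natrD in t2 => t1.
  by have := congr1 (fun z => u * z) t2; lra.
have [d2_gt4|d2_le4] := ltnP 4 d2; last first.
  have := @La 58 ltac:(natlia); have := @Ua 8 isT ltac:(natlia); rewrite /ladder /=; lra.
have := @u_le 4 a isT (@La 4 ltac:(natlia)); have := @u_le 4 b isT (@Lb 4 ltac:(natlia)).
move=> /(@term_ge0 d2) tb /(@term_ge0 d1) ta.
have [|dc _ _] := @defect_ge d3 c ltac:(natlia); first by move=> j jm; apply: Lc; natlia.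
lra.
Qed.

(** Here [a], [b] and [a + b] would all be close to [u >= 1]. *)
Lemma one_large_pair_false : (76 < d1 + d2)%N -> (d1 + d3 < 76)%N -> False.
Proof.
move=> D12 D13; have := @La 0 ltac:(natlia); have := @Lb 0 ltac:(natlia).
have := @Uab 75 isT ltac:(natlia); rewrite /ladder /=; have := u_ge1.
case: sep => -[? ? ? ?] ? [? ? ?] ?; lra.
Qed.

(** A projection of full rank has [a] below the least eigenvalue, so [a] occurs
    at most once as a value; then [- h1] is all the negative trace there is. *)
Lemma full_rank_false : d1 = 76%N -> (d2 + d3 < 76)%N -> False.
Proof.
move=> d1E D23; have [h1p h2p T1 T2 T3] := T_bounds; case: sep => -[? ? ? ?] _ [? ? ?] _.
have := @Ua 0 isT ltac:(natlia); rewrite /ladder /= => a0.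
have [D23'|D23'] := ltnP (d2 + d3) 75.
  have := @La 1 ltac:(natlia); rewrite /ladder /=; lra.
have := @Lab 38 ltac:(natlia); rewrite /ladder /= => ab.
have [d2_ge72|d2_lt72] := leqP 72 d2.
  have := @Uab 4 isT ltac:(natlia); rewrite /ladder /=; lra.
have := @Lac 4 ltac:(natlia) => /(@u_le 4 _ isT) /(@term_ge0 d3) tac.
have /(@term_ge0 d2) tab : 0 <= a + b - u by lra.
have := @La 0 ltac:(natlia); rewrite /ladder /= => a0'.
have := natr_sum (_ : (d2 + d3 = 75)%N) => /(_ ltac:(natlia)) D.
have : (a - u) + d2%:R * (a + b - u) + d3%:R * (a + c - u) = - T.
  have t1 := trace; rewrite d1E in t1.
  have := congr1 (fun z => u * z) D; have := congr1 (fun z => a * z) D; lra.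
lra.
Qed.

Let mulr_bound (x y : R) (m k : nat) : x <= y -> 0 <= y -> (m <= k)%N ->
  x * m%:R <= y * k%:R.
Proof.
move=> xy y0 mk; apply: le_trans (_ : y * m%:R <= _).
  by rewrite ler_wpM2r.
by rewrite ler_wpM2l // ler_nat.
Qed.

Let T_le : T <= 2 * h1.
Proof. by case: sep => -[? ? ? ?] ? [? ? ?] ?; rewrite /T; lra. Qed.

(** If [a], [a + b] and [a + c] all occur, then [b] and [c] are nearly zero and
    the trace is short by [(76 - d1) * u]. Otherwise [d1 + d3 = 76]: for small
    [d3] one of [a], [a + b] occurs too often, for large [d3] the blocks and
    [a + b] have nonnegative shares. *)
Lemma two_large_pairs_false : (d1 < 76)%N -> (76 <= d1 + d3)%N ->
  (d2 + d3 < 76)%N -> False.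
Proof.
move=> d1_lt D13 D23; have [h1p h2p T1 T2 T3] := T_bounds.
case: sep => -[? ? ? ?] ? [? ? ?] ?.
have [D13'|D13'] := ltnP 76 (d1 + d3).
  have := @La 0 ltac:(natlia); have := @Uab 75 isT ltac:(natlia).
  have := @Uac 75 isT ltac:(natlia); rewrite /ladder /= => ac ab a0.
  have ? := u_ge1; have ? := b_ge0; have ? := c_ge0.
  have := @mulr_bound a (u + g4) d1 75 ltac:(lra) ltac:(lra) ltac:(natlia).
  have := @mulr_bound b (g4 + h1) d2 76 ltac:(lra) ltac:(lra) ltac:(natlia).
  have := @mulr_bound c (g4 + h1) d3 76 ltac:(lra) ltac:(lra) ltac:(natlia).
  have := trace; have := T_le; lra.
have [d3_le8|d3_gt8] := leqP d3 8.
  have := @Lab 58 ltac:(natlia); rewrite /ladder /= => ab.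
  have [D12|D12] := leqP 95 (d1 + d2).
    have := @Uab 57 isT ltac:(natlia); rewrite /ladder /=; lra.
  have := @La 40 ltac:(natlia); have := @Ua 8 isT ltac:(natlia).
  rewrite /ladder /=; lra.
have [m1 m1E] : {m1 | m1 + d2 + d3 = 76}%N by exists (76 - d2 - d3)%N; natlia.
have [m12 d2E] : {m12 | d2 = m12 + d3}%N by exists (d2 - d3)%N; natlia.
have d1E : (d1 + d3 = 76)%N by natlia.
have ma : mult m1 a by move=> j jm; apply: La; natlia.
have [da _ _] := @defect_ge m1 a ltac:(natlia) ma.
have := @pair 4 4 ltac:(natlia) ltac:(natlia) ltac:(natlia) ltac:(natlia).
have g4p := @ladder_pos 4 isT => p44.
have := @term_ge0 d3 (a + b + c - 2 * u) ltac:(lra) => ptr.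
have /(@term_ge0 m12) tab := @u_le 4 (a + b) isT (@Lab 4 ltac:(natlia)).
have : m1%:R * (a - u) + m12%:R * (a + b - u) + d3%:R * (a + b + c - 2 * u) = - T.
  have t1 := trace; have := natr_sum d1E; have := natr_sum m1E.
  rewrite d2E !natrD in t1 * => t2 t3.
  have := congr1 (fun z => u * z) t2; have := congr1 (fun z => a * z) t3.
  have := congr1 (fun z => a * z) t2; lra.
lra.
Qed.

(** The types are the three pairs and, [d1 + d2 + d3 - 152] times, the full sum
    [a + b + c], which must be the top level; so it occurs at most 18 times
    and at most one of the pairs can be rare. *)
Lemma large_rank_sum_false : (152 <= d1 + d2 + d3)%N -> False.
Proof.
move=> D; have [h1p h2p T1 T2 T3] := T_bounds; case: sep => -[? ? ? ?] _ _ _.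
have := @Labc 75 isT; rewrite /ladder /= => abc.
have [D'|D'] := leqP 171 (d1 + d2 + d3).
  have := @Uabc 57 isT ltac:(natlia); rewrite /ladder /=; lra.
have [d2_ge72|d2_lt72] := leqP 72 d2.
  have := @Lab 40 ltac:(natlia); have := @Uab 8 isT ltac:(natlia).
  rewrite /ladder /=; lra.
have [n1 n1E] : {n1 | n1 + d1 = 76}%N by exists (76 - d1)%N; natlia.
have [n2 n2E] : {n2 | n2 + d2 = 76}%N by exists (76 - d2)%N; natlia.
have [n3 n3E] : {n3 | n3 + d3 = 76}%N by exists (76 - d3)%N; natlia.
have [k kE] : {k | k + 152 = d1 + d2 + d3}%N by exists (d1 + d2 + d3 - 152)%N; natlia.
have /(@term_ge0 n3) tab := @u_le 4 (a + b) isT (@Lab 4 ltac:(natlia)).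
have /(@term_ge0 n2) tac := @u_le 4 (a + c) isT (@Lac 4 ltac:(natlia)).
have /(@term_ge0 k) tabc : 0 <= a + b + c - u by lra.
have [|dbc _ _] := @defect_ge n1 (b + c) ltac:(natlia).
  by move=> j jn; apply: Lbc; natlia.
have : n1%:R * (b + c - u) + n2%:R * (a + c - u) + n3%:R * (a + b - u)
    + k%:R * (a + b + c - u) = - T.
  have t1 := trace; have e1 := natr_sum n1E; have e2 := natr_sum n2E.
  have e3 := natr_sum n3E; have e4 := natr_sum kE; rewrite !natrD in e4.
  have -> : n1%:R = 76 - d1%:R :> R by lra.
  have -> : n2%:R = 76 - d2%:R :> R by lra.
  have -> : n3%:R = 76 - d3%:R :> R by lra.
  have -> : k%:R = d1%:R + d2%:R + d3%:R - 152 :> R by lra.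
  lra.
lra.
Qed.

(** The types are the three pairs and [p] blocks. Many blocks have a nonnegative
    share by [pair], and so have the pairs. With few blocks the three pairs
    cannot all occur, as that would give [2 (a + b + c)] near [3 u] against
    [a + b + c] near [2 u], which the trace imposes; so [d2 + d3 = 76]. *)
Lemma large_pairs_false : (76 <= d2 + d3)%N -> (d1 + d2 + d3 < 152)%N -> False.
Proof.
move=> D23 D; have [h1p h2p T1 T2 T3] := T_bounds; case: sep => -[? ? ? ?] ? [? ? ?] ?.
have [r12 r12E] : {r | r + 76 = d1 + d2}%N by exists (d1 + d2 - 76)%N; natlia.
have [r13 r13E] : {r | r + 76 = d1 + d3}%N by exists (d1 + d3 - 76)%N; natlia.
have [r23 r23E] : {r | r + 76 = d2 + d3}%N by exists (d2 + d3 - 76)%N; natlia.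
have [p pE] : {p | p + (d1 + d2 + d3) = 152}%N.
  by exists (152 - (d1 + d2 + d3))%N; natlia.
have e1 := natr_sum r12E; have e2 := natr_sum r13E; have e3 := natr_sum r23E.
have e4 := natr_sum pE; rewrite !natrD in e1 e2 e3 e4.
have tr : r23%:R * (b + c - u) + r13%:R * (a + c - u) + r12%:R * (a + b - u)
    + p%:R * (a + b + c - 2 * u) = - T.
  have t1 := trace.
  have -> : r12%:R = d1%:R + d2%:R - 76 :> R by lra.
  have -> : r13%:R = d1%:R + d3%:R - 76 :> R by lra.
  have -> : r23%:R = d2%:R + d3%:R - 76 :> R by lra.
  have -> : p%:R = 152 - (d1%:R + d2%:R + d3%:R) :> R by lra.
  lra.
have [D143|D144] := leqP (d1 + d2 + d3) 143.
  have := @pair 4 4 ltac:(natlia) ltac:(natlia) ltac:(natlia) ltac:(natlia).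
  have g4p := @ladder_pos 4 isT => p44.
  have := @term_ge0 p (a + b + c - 2 * u) ltac:(lra) => ptr.
  have /(@term_ge0 r12) tab := @u_le 4 (a + b) isT (@Lab 4 ltac:(natlia)).
  have /(@term_ge0 r13) tac := @u_le 4 (a + c) isT (@Lac 4 ltac:(natlia)).
  have /(@term_ge0 r23) tbc := @u_le 4 (b + c) isT (@Lbc 4 ltac:(natlia)).
  lra.
have [D23'|D23'] := ltnP 76 (d2 + d3).
  have := @Uab 75 isT ltac:(natlia); have := @Uac 75 isT ltac:(natlia).
  have := @Ubc 75 isT ltac:(natlia); rewrite /ladder /= => bc ac ab.
  have ab0 : 0 <= r12%:R * (u + g4 - (a + b)) by apply: term_ge0; lra.
  have ac0 : 0 <= r13%:R * (u + g4 - (a + c)) by apply: term_ge0; lra.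
  have bc0 : 0 <= r23%:R * (u + g4 - (b + c)) by apply: term_ge0; lra.
  have s0 : 0 <= p%:R * (3 * (u + g4) - 2 * (a + b + c)) by apply: term_ge0; lra.
  have u1 := u_ge1.
  have := @mulr_bound (u + g4) (u + g4) (d1 + d2 + d3) 151 ltac:(lra) ltac:(lra)
    ltac:(natlia).
  rewrite !natrD; have := T_le.
  have f1 := congr1 (fun z => (u + g4) * z) e1.
  have f2 := congr1 (fun z => (u + g4) * z) e2.
  have f3 := congr1 (fun z => (u + g4) * z) e3.
  have f4 := congr1 (fun z => (u + g4) * z) e4.
  have k1 := congr1 (fun z => u * z) e1; have k2 := congr1 (fun z => u * z) e2.
  have k3 := congr1 (fun z => u * z) e3; have k4 := congr1 (fun z => u * z) e4.
  lra.
have [d3_ge|d3_lt] := leqP 27 d3; last first.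
  have := @Lab 49 ltac:(natlia); have := @Uab 34 isT ltac:(natlia).
  rewrite /ladder /=; lra.
(* The 18 eigenvalues at the top level and their mirror images show that
   [a + b] and [a + c] add up to at least [2 u + g4 + g1], while their
   multiplicities keep each of them below [u + g3]. *)
have := @pair_shift 58 17 isT ltac:(natlia) ltac:(natlia) ltac:(natlia).
have := @Uab 46 isT ltac:(natlia); have := @Uac 57 isT ltac:(natlia).
rewrite /ladder /=; lra.
Qed.

Lemma no_admissible_weights : False.
Proof.
have [|D12|D12] := ltngtP (d1 + d2) 76; first exact: slack_pairs_false.
  have [D13|D13] := ltnP (d1 + d3) 76; first exact: one_large_pair_false.
  have [D23|D23] := ltnP (d2 + d3) 76.
    have [d1_lt|d1_ge] := ltnP d1 76; first exact: two_large_pairs_false.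
    by apply: full_rank_false => //; lia.
  have [D|D] := leqP 152 (d1 + d2 + d3); first exact: large_rank_sum_false.
  exact: large_pairs_false.
exact: tight_pair_false.
Qed.
End Arithmetic.

(** * No nonnegative combination has the given spectrum *)

Section LadderSpectrum.
Variables (R : realType) (h1 h2 h3 h4 g1 g2 g3 g4 : R).
Hypothesis sep : scales_separated h1 h2 h3 h4 g1 g2 g3 g4.
Let E := ladder h1 h2 h3 h4 g1 g2 g3 g4.

Lemma ladder_mono j k : (j <= k < 76)%N -> E j <= E k.
Proof.
case: sep => -[? ? ? ?] ? [? ? ?] _ /andP[jk k76].
apply: (@sorted_leq_nth _ <=%R le_trans lexx 0 _ _ j k); rewrite ?inE //=.
  have o1 : - h1 <= - h2 by lra.
  have o2 : - h2 <= - h3 by lra.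
  have o3 : - h3 <= - h4 by lra.
  have o4 : - h4 <= g1 by lra.
  have o5 : g1 <= g2 by lra.
  have o6 : g2 <= g3 by lra.
  have o7 : g3 <= g4 by lra.
  by rewrite o1 o2 o3 o4 o5 o6 o7 !lexx.
exact: leq_ltn_trans jk k76.
Qed.

Lemma ladder_sum : \sum_(j < 76) E j
  = - (h1 + h2 + h3 + h4 - 18 * (g1 + g2 + g3 + g4)).
Proof.
rewrite -(big_mkord xpredT E) /E /ladder.
rewrite -[76%N]/(size ([:: - h1; - h2; - h3; - h4]
   ++ nseq 18 g1 ++ nseq 18 g2 ++ nseq 18 g3 ++ nseq 18 g4)).
rewrite -(big_nth 0 xpredT id) !big_cat !big_nseq !big_cons big_nil /=.
ring.
Qed.

Lemma ladder_not_nonneg_comb (u a b c : R) (P Q S : 'M[R[i]]_76) :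
  1 <= u -> 0 <= a -> 0 <= b -> 0 <= c ->
  orthoprojection P -> orthoprojection Q -> orthoprojection S ->
  diag_mx (\row_(j < 76) (u + E j)%:C) = a%:C *: P + b%:C *: Q + c%:C *: S ->
  False.
Proof.
wlog [PQ QS] : a b c P Q S / (\rank Q <= \rank P)%N /\ (\rank S <= \rank Q)%N.
  move=> H u1 a0 b0 c0 oP oQ oS.
  case: (leqP (\rank Q) (\rank P)) => [QP|/ltnW PQ];
    case: (leqP (\rank S) (\rank Q)) => [SQ|/ltnW QS];
    case: (leqP (\rank S) (\rank P)) => [SP|/ltnW PS] AE.
  - exact: (H a b c P Q S).
  - by apply: (H a b c P Q S) => //; lia.
  - by apply: (H a c b P S Q) => //; rewrite AE addrAC.
  - by apply: (H c a b S P Q) => //; rewrite AE addrC addrA.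
  - by apply: (H b a c Q P S) => //; rewrite AE [in RHS](addrC (b%:C *: Q)).
  - by apply: (H b c a Q S P) => //; rewrite AE -addrA addrC.
  - by apply: (H b c a Q S P) => //; try lia; rewrite AE -addrA addrC.
  - apply: (H c b a S Q P) => //.
    by rewrite AE -addrA addrC (addrC (c%:C *: S)).
move=> u1 a0 b0 c0 oP oQ oS AE.
have mono j k : (j <= k < 76)%N -> u + E j <= u + E k.
  by move=> /ladder_mono; rewrite lerD2l.
have AEs : diag_mx (\row_(j < 76) (u + E j)%:C)
    = c%:C *: S + a%:C *: P + b%:C *: Q.
  by rewrite AE [in RHS]addrAC [in RHS]addrC addrA [in RHS]addrAC.
pose e j := u + E j.
apply: (@no_admissible_weights R h1 h2 h3 h4 g1 g2 g3 g4 sep u a b c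
  (\rank P) (\rank Q) (\rank S)) => //.
- exact: rank_leq_row.
- rewrite -(trace_comb (e := e) oP oQ oS AE) big_split /= ladder_sum.
  by rewrite sumr_const card_ord; ring.
- by move=> s t r j; apply: (weight_ge (e := e) mono a0 b0 c0 oP oQ oS AE).
- by move=> s t r j; apply: (weight_le (e := e) mono a0 b0 c0 oP oQ oS AE).
- move=> j l k1 k2 k3 k4.
  have := pair_sum_ge (e := e) mono a0 b0 c0 oP oQ oS AE k1 k2 k3 k4.
  by apply: etrans; congr (_ <= _); rewrite /e /E; ring.
- move=> j l k1 k2 k3 k4.
  have := pair_sum_ge_shift (e := e) mono a0 b0 c0 oP oQ oS AE k1 k2 k3 k4.
  by apply: etrans; congr (_ <= _); rewrite /e /E; ring.
- move=> j l k1 k2 k3 k4.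
  have := pair_sum_ge_ker (e := e) mono c0 a0 b0 oS oP oQ AEs k1 k2 k3 k4.
  by apply: etrans; congr (_ <= _); rewrite /e /E; ring.
Qed.
End LadderSpectrum.

(** * The matrix of the theorem *)

Section Instance.
Variables (R : realType) (theta : R).
Hypotheses (theta_gt0 : 0 < theta) (theta_le1 : theta <= 1).

Definition scale (k : nat) : R := (10 ^+ 10)^-1 ^+ k * theta.

Lemma scale_gt0 k : 0 < scale k.
Proof. by rewrite mulr_gt0 // exprn_gt0 // invr_gt0 exprn_gt0. Qed.

Lemma scale_step j k : (j < k)%N -> 20 * (20 * scale k) <= scale j.
Proof.
move=> jk; rewrite /scale; set z := _^-1.
have z0 : 0 < z by rewrite invr_gt0 exprn_gt0.
have zE : 10 ^+ 10 * z = 1 by rewrite mulfV // gt_eqF // exprn_gt0.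
have z400 : 20 * (20 * z) <= 1.
  rewrite mulrA -[leRHS]zE ler_pM2r //.
  have le400 : (20 * 20 : R) <= 10 ^+ 3 by lra.
  by apply: le_trans le400 _; rewrite ler_eXn2l // ltr1n.
have zk : z ^+ k <= z * z ^+ j by rewrite -exprS ler_wiXn2l ?ltW //; lra.
rewrite !mulrA ler_pM2r //.
have zj : 0 < z ^+ j by rewrite exprn_gt0.
have : 0 <= (1 - 20 * (20 * z)) * z ^+ j by rewrite mulr_ge0 ?subr_ge0 // ltW.
lra.
Qed.

Lemma exp10_scale (k : nat) (z : int) : z = - (10 * k%:Z) ->
  (10 : R) ^ z * theta = scale k.
Proof. by move=> ->; rewrite -invr_expz -exprz_exp /scale exprVn. Qed.

Lemma entry_ladder j : (j < 76)%N ->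
  (diag_entries theta)`_j = 1 + ladder (scale 1) (scale 2) (scale 3) (scale 4)
    (scale 40) (scale 30) (scale 20) (scale 10) j.
Proof.
move=> j76; rewrite /diag_entries.
have muE i : mu theta i = 1 - scale i by rewrite /mu (exp10_scale erefl).
have gammaE (i k : nat) : 100 * (i%:Z - 5) = - (10 * k%:Z) ->
    gamma theta i = 1 + scale k by rewrite /gamma => /exp10_scale->.
rewrite !muE (gammaE 1 40) // (gammaE 2 30) // (gammaE 3 20) // (gammaE 4 10) //.
rewrite /ladder.
do 76 (case: j j76 => [|j] j76 //=).
Qed.

Lemma scale_separated : scales_separated (scale 1) (scale 2) (scale 3) (scale 4)
    (scale 40) (scale 30) (scale 20) (scale 10).
Proof.
have p := scale_gt0; have st := scale_step.
have := p 40; have := p 4; have := p 10; have := p 30; have := p 20.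
have := p 3; have := p 2; have := p 1.
have := st 30 40 isT; have := st 20 30 isT; have := st 10 20 isT.
have := st 4 10 isT; have := st 3 4 isT; have := st 2 3 isT.
have := st 1 2 isT; have := st 0 1 isT.
have -> : scale 0 = theta by rewrite /scale expr0 mul1r.
have := theta_le1 => *.
by split; [split; lra | lra | split; lra | lra].
Qed.

End Instance.

(** A negative weight becomes positive on the complementary projection, at the
    price of a nonnegative scalar matrix. *)
Lemma flip_sign (R : realType) n (alpha : R) (P : 'M[R[i]]_n) :
  orthoprojection P ->
  exists (t a : R) (Q : 'M[R[i]]_n), [/\ 0 <= t, 0 <= a, orthoprojection Q
    & t%:C%:M + alpha%:C *: P = a%:C *: Q].
Proof.
move=> oP; have [a0|/ltW a0] := leP 0 alpha.
  by exists 0, alpha, P; split=> //; rewrite raddf0 add0r.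
exists (- alpha), (- alpha), (1%:M - P); split; rewrite ?oppr_ge0 //.
  exact: orthoprojection_compl.
have aN : (- alpha)%:C = - alpha%:C by rewrite (rmorphN (real_complex R)).
by rewrite aN -[X in X + _]scalemx1 !scaleNr scalerBr opprB addrC.
Qed.

Unset Implicit Arguments.
Theorem proposition4p6 (R : realType) (theta : R)
    (theta_gt0 : 0 < theta) (theta_le1 : theta <= 1) :
  ~ exists (alpha1 alpha2 alpha3 : R) (P1 P2 P3 : 'M[R[i]]_76),
      [/\ orthoprojection P1, orthoprojection P2, orthoprojection P3
        & A76 theta = alpha1%:C *: P1 + alpha2%:C *: P2 + alpha3%:C *: P3].
Proof.
case=> x1 [x2 [x3 [P1 [P2 [P3 [o1 o2 o3 AE]]]]]].
have [t1 [a1 [Q1 [t1_ge0 a1_ge0 oQ1 E1]]]] := flip_sign x1 o1.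
have [t2 [a2 [Q2 [t2_ge0 a2_ge0 oQ2 E2]]]] := flip_sign x2 o2.
have [t3 [a3 [Q3 [t3_ge0 a3_ge0 oQ3 E3]]]] := flip_sign x3 o3.
apply: (ladder_not_nonneg_comb (scale_separated theta_gt0 theta_le1)
  (u := 1 + (t1 + t2 + t3)) _ a1_ge0 a2_ge0 a3_ge0 oQ1 oQ2 oQ3).
  by rewrite lerDl !addr_ge0.
rewrite -E1 -E2 -E3 [RHS](_ : _ = A76 theta + (t1 + t2 + t3)%:C%:M); last first.
  rewrite AE !(rmorphD (real_complex R)) !raddfD /=.
  by rewrite [X in X + _ = _]addrACA [LHS]addrACA [LHS]addrC.
apply/matrixP=> j k; rewrite !mxE entry_ladder //.
have [->|jk] := eqVneq j k; last by rewrite !mulr0n addr0.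
by rewrite !mulr1n -(rmorphD (real_complex R)); congr (_%:C); rewrite addrAC.
Qed.
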